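(* Let $K$ be a field. Then, as sets, $$\mathrm{GBS}(K) = R(K)\times \mathbb{Z},$$ i.e. the set of all irreducible left $FK$-glider ideals of $K$, where $FK$ runs over all filtrations on $K$, is in bijection with the product of the set $R(K)$ of discrete valuation rings of $K$ and $\mathbb{Z}$.
   Context: A filtration $FK$ on the field $K$ is an ascending chain $\cdots\subset F_{-1}K\subset F_0K\subset F_1K\subset\cdots$ of additive subgroups of $K$ indexed by $\mathbb{Z}$ with $F_nK\,F_mK\subset F_{n+m}K$ for all $n,m$, $F_0K$ being a subring. All filtrations are assumed separated ($\bigcap_n F_nK=0$), exhaustive ($\bigcup_n F_nK=K$) and not bounded (all $F_nK\neq 0$, and no $m$ satisfies $F_mK=K$). A left $FK$-glider ideal of $K$ is a descending chain $M=M_0\supset M_1\supset M_2\supset\cdots$ of $F_0K$-submodules of $K$ such that $F_iK\,M_j\subset M_{j-i}$ for all $i\in\mathbb{Z}$, $j\in\mathbb{N}$ with $i\le j$. Its body is $B(M)=\bigcap_j M_j$. A subglider of $M$ is a glider $N=N_0\supset N_1\supset\cdots$ with $N_i\subset M_i$ for all $i$. It is trivial if one of the following holds: $(T_1)$ there is $n\in\mathbb{N}$ with $N_n=B(N)$ but $M_n\ne B(M)$; $(T_2)$ there is $n\in\mathbb{N}$ with $N_n=0$ but $M_n\neq 0$; $(T_3)$ there is a monotone increasing map $\alpha:\mathbb{N}\to\mathbb{N}$ with $N_n=M_{\alpha(n)}$ for all $n$ and $\alpha(n)-m\ge\alpha(n-m)$ for all $m\le n$. A glider is irreducible if it is nonzero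 and all its subgliders are trivial. $\mathrm{GBS}_F(K)$ is the set of irreducible left $FK$-glider ideals of $K$, and $\mathrm{GBS}(K)=\bigcup_{FK}\mathrm{GBS}_F(K)$, the union over all filtrations $FK$ on $K$. $R(K)$ (the Riemann surface of $K$) is the set of all discrete valuation rings with field of fractions $K$. *)

(* Defs.v *)
From mathcomp Require Import all_boot all_order all_algebra.
From mathcomp Require Import classical_sets functions.

Set Implicit Arguments.
Unset Strict Implicit.
Unset Printing Implicit Defensive.

Import Order.TTheory GRing.Theory Num.Theory.

Local Open Scope classical_set_scope.
Local Open Scope ring_scope.

Section Gliders.

Variable K : fieldType.

(* The product [A B] of two subsets, as the set of elementary products: it is
   only ever required to lie in an additive subgroup, which is the same as
   requiring this of the subgroup it generates. *)
Definition prodset (A B : set K) : set K := [set a * b | a in A & b in B].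

Record is_filtration (F : int -> set K) : Prop := IsFiltration {
  filt_additive : forall n, zmod_closed [in F n];
  filt_chain : forall n, F n `<=` F (n + 1);
  filt_mul : forall n m, prodset (F n) (F m) `<=` F (n + m);
  filt_subring : subring_closed [in F 0];
  filt_separated : \bigcap_n F n = [set 0];
  filt_exhaustive : \bigcup_n F n = [set: K];
  filt_neq0 : forall n, F n <> [set 0];
  filt_neqT : ~ exists m, F m = [set: K]
}.

Definition filtrations : set (int -> set K) := [set F | is_filtration F].

Definition is_submodule (A X : set K) : Prop :=
  zmod_closed [in X] /\ prodset A X `<=` X.

Record is_glider (F : int -> set K) (M : nat -> set K) : Prop := IsGlider {
  glider_submodule : forall j, is_submodule (F 0) (M j);
  glider_chain : forall j, M j.+1 `<=` M j;
  (* [j - i] is computed in [int]; it is nonnegative as [i <= j]. *)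
  glider_act : forall (i : int) (j : nat), i <= j%:Z ->
    prodset (F i) (M j) `<=` M `|j%:Z - i|%N
}.

Definition body (M : nat -> set K) : set K := \bigcap_j M j.

Definition is_subglider (F : int -> set K) (M N : nat -> set K) : Prop :=
  is_glider F N /\ forall i, N i `<=` M i.

Definition trivial1 (M N : nat -> set K) : Prop :=
  exists n, N n = body N /\ M n <> body M.

Definition trivial2 (M N : nat -> set K) : Prop :=
  exists n, N n = [set 0] /\ M n <> [set 0].

(* The last inequality is between integers: with the truncated subtraction of
   [nat] it would also hold when [alpha n < m] and [alpha (n - m) = 0]. *)
Definition trivial3 (M N : nat -> set K) : Prop :=
  exists alpha : nat -> nat,
    [/\ {homo alpha : m n / (m <= n)%N},
        forall n, N n = M (alpha n)
      & forall m n : nat, (m <= n)%N ->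
          (alpha n)%:Z - m%:Z >= (alpha (n - m)%N)%:Z].

Definition is_trivial (M N : nat -> set K) : Prop :=
  [\/ trivial1 M N, trivial2 M N | trivial3 M N].

Record is_irreducible (F : int -> set K) (M : nat -> set K) : Prop :=
  IsIrreducible {
    irr_glider : is_glider F M;
    irr_neq0 : exists n, M n <> [set 0];
    irr_trivial : forall N, is_subglider F M N -> is_trivial M N
}.

Definition GBS_of (F : int -> set K) : set (nat -> set K) :=
  [set M | is_irreducible F M].

(* A plain union of sets of chains: a chain that is irreducible for several
   filtrations counts once. *)
Definition GBS : set (nat -> set K) := \bigcup_(F in filtrations) GBS_of F.

(* A discrete valuation of [K], surjective onto [int]. It is a function on the
   nonzero elements: its value at 0 is irrelevant. *)
Record is_discrete_valuation (v : K -> int) : Prop := IsDiscreteValuation {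
  dv_mul : forall x y : K, x != 0 -> y != 0 -> v (x * y) = v x + v y;
  dv_add : forall x y : K, x != 0 -> y != 0 -> x + y != 0 ->
    Num.min (v x) (v y) <= v (x + y);
  dv_surj : forall n : int, exists2 x : K, x != 0 & v x = n
}.

Definition valuation_ring (v : K -> int) : set K :=
  [set x | x = 0 \/ 0 <= v x].

(* The field of fractions of [valuation_ring v] is [K] because [v] is defined
   on all of [K]: each nonzero [x] has [x] or [x^-1] in the ring. *)
Definition riemann_surface : set (set K) :=
  [set A | exists2 v, is_discrete_valuation v & A = valuation_ring v].

End Gliders.

Arguments filtrations K : clear implicits.
Arguments GBS K : clear implicits.
Arguments riemann_surface K : clear implicits.

(* Main.v *)
Require Import Defs.
From HB Require Import structures.
From mathcomp Require Import all_boot all_order all_algebra.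
From mathcomp Require Import boolp classical_sets functions cardinality.
From mathcomp Require Import zify.

(** By Cantor-Bernstein it suffices to inject each set into the other.

    From [R(K) x Z] into [GBS(K)]: for a discrete valuation [v] with ring [A]
    and [c] in [Z], the chain of fractional ideals [{v >= c + j}], [j >= 0], is
    irreducible for the filtration [F_n = {v >= - n}] ([ball_irreducible]),
    because a subglider is determined by its first term and is therefore zero
    or a shift of the chain.  The first term of the chain gives back [A], as
    the ring of its multipliers, and then [c].

    From [GBS(K)] into [R(K) x Z]: let [M] be irreducible for [F].  For
    [a <> 0] in [M_0] the glider [F_(-n) a] is a subglider which cannot be
    trivial of type (T1) or (T2), since its terms are nonzero while its body is
    zero.  So it is trivial of type (T3), and [F_0 a] is a term of [M].  The
    cyclic submodules of [M_0] are thus terms of one descending sequence, so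
    that every submodule of [M_0] has a generator: one whose cyclic module comes
    first in the sequence ([irr_generator]).  It follows that [F_0] is a
    discrete valuation ring of [K] ([irr_dvr]), and that
    [M_j = {v >= m_j}] for a sequence of integers [m] ([irr_ball]).

    This does not yet bound the number of [M] over a given ring: when [F] has
    repeated steps, [M] can have repeated steps too, and so the chains
    [{v >= c + j}] are not all of the irreducible ones.  But for a uniformizer
    [t] the subglider [t M] must again be of type (T3), and this yields a map
    [alpha] with [m (alpha n) = m n + 1] for which [alpha n - n] is
    nondecreasing.  That difference is bounded, because [t^-1] lies in some
    [F_p]; so it is eventually constant and [m (n + s) = m n + 1] for large [n]
    ([irr_periodic]).  Finitely many integers then determine [m], so only
    countably many irreducible gliders share a given ring. *)

Local Open Scope classical_set_scope.

Section GliderIdeals.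

Set Implicit Arguments.
Unset Strict Implicit.

Import Order.TTheory GRing.Theory Num.Theory.
Local Open Scope ring_scope.

Variable K : fieldType.

Implicit Types (A X : set K) (F : int -> set K) (M N P : nat -> set K).
Implicit Types (v : K -> int) (a x y t : K).

(** * Additive subgroups and their multiples *)

Definition scale a X : set K := [set x * a | x in X].

Lemma scaleP a X x : a != 0 -> scale a X x <-> X (x / a).
Proof.
move=> a0; split=> [[y Xy <-]|Xx]; first by rewrite mulfK.
by exists (x / a) => //; rewrite mulfVK.
Qed.

Lemma zmod_setP X :
  zmod_closed [in X] <-> X 0 /\ (forall x y, X x -> X y -> X (x - y)).
Proof.
split=> [[X0 XB]|[X0 XB]].
  split=> [|x y Xx Xy]; apply: set_mem; first exact: X0.
  by apply: XB; exact: mem_set.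
split=> [|x y Xx Xy]; apply: mem_set => //.
by apply: XB; apply: set_mem.
Qed.

Lemma zmod_set0 X : zmod_closed [in X] -> X 0.
Proof. by case/zmod_setP. Qed.

Lemma zmod_setB X x y : zmod_closed [in X] -> X x -> X y -> X (x - y).
Proof. by case/zmod_setP => _; apply. Qed.

Lemma zmod_setN X x : zmod_closed [in X] -> X x -> X (- x).
Proof.
by move=> Xz Xx; rewrite -sub0r; apply: zmod_setB => //; exact: zmod_set0.
Qed.

Lemma zmod_setD X x y : zmod_closed [in X] -> X x -> X y -> X (x + y).
Proof.
by move=> Xz Xx Xy; rewrite -[y]opprK; apply: zmod_setB => //; exact: zmod_setN.
Qed.

Lemma zmod_neq0 X : zmod_closed [in X] -> X <> [set 0] ->
  exists2 x, x != 0 & X x.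
Proof.
move=> Xz nX; apply: contrapT => H; apply: nX; apply/seteqP; split=> x /=.
  by move=> Xx; apply: contrapT => /eqP x0; apply: H; exists x.
by move=> ->; apply: zmod_set0.
Qed.

Lemma scale_zmod a X : a != 0 -> zmod_closed [in X] -> zmod_closed [in scale a X].
Proof.
move=> a0 Xz; apply/zmod_setP; split.
  by apply/scaleP => //; rewrite mul0r; exact: zmod_set0.
move=> x y /scaleP-/(_ a0) Xx /scaleP-/(_ a0) Xy; apply/scaleP => //.
by rewrite mulrBl; exact: zmod_setB.
Qed.

Lemma scale_eq0 a X : a != 0 -> scale a X = [set 0] -> X = [set 0].
Proof.
move=> a0 E; apply/seteqP; split=> x.
  move=> Xx; have : scale a X (x * a) by exists x.
  by rewrite E => /= /eqP; rewrite mulf_eq0 (negPf a0) orbF => /eqP.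
move=> /= ->; have : scale a X 0 by rewrite E.
by move=> /scaleP-/(_ a0); rewrite mul0r.
Qed.

(** * Filtrations and gliders *)

Lemma filt_mono F m n : is_filtration F -> m <= n -> F m `<=` F n.
Proof.
move=> hF mn; have -> : n = m + `|n - m|%N%:Z by lia.
elim: `|n - m|%N => [|k IH]; first by rewrite addr0.
apply: subset_trans IH _; have -> : m + k.+1%:Z = m + k%:Z + 1 by lia.
exact: (filt_chain hF).
Qed.

Lemma filt0M F x y : is_filtration F -> F 0 x -> F 0 y -> F 0 (x * y).
Proof.
move=> hF Fx Fy; have := filt_mul hF (n := 0) (m := 0); rewrite addr0; apply.
by exists x => //; exists y.
Qed.

Lemma filt01 F : is_filtration F -> F 0 1.
Proof. by move=> hF; apply: set_mem; case: (filt_subring hF). Qed.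

(** The separation axiom, read off from the steps of nonpositive degree. *)
Lemma filt_body F x : is_filtration F -> (forall j : nat, F (- j%:Z) x) -> x = 0.
Proof.
move=> hF Fx; have : (\bigcap_n F n) x.
  by move=> n _; apply: (filt_mono hF (m := - `|n|%N%:Z)); [lia|exact: Fx].
by rewrite (filt_separated hF).
Qed.

Lemma filt_elt F x : is_filtration F -> exists n : nat, F n%:Z x.
Proof.
move=> hF; have : (\bigcup_n F n) x by rewrite (filt_exhaustive hF).
case=> n _ Fx; exists `|n|%N; apply: (filt_mono hF) Fx; lia.
Qed.

(** The action of [F] with the target degree as a free variable, so that no
    absolute value of an integer has to be computed. *)
Lemma gliderM F M x y (i : int) (j k : nat) : is_glider F M ->
  F i x -> M j y -> i + k%:Z = j%:Z -> M k (x * y).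
Proof.
move=> gM Fx My e; have -> : k = `|j%:Z - i|%N by lia.
by apply: (glider_act gM); [lia|exists x => //; exists y].
Qed.

Lemma glider_zmod {F M j} : is_glider F M -> zmod_closed [in M j].
Proof. by move=> gM; case: (glider_submodule gM j). Qed.

Lemma glider_mono F M (i j : nat) : is_glider F M -> (i <= j)%N -> M j `<=` M i.
Proof.
move=> gM /subnK <-; elim: (j - i)%N => [//|k IH].
by apply: subset_trans IH; exact: (glider_chain gM).
Qed.

Lemma scale_glider F P a : a != 0 -> is_glider F P ->
  is_glider F (fun n => scale a (P n)).
Proof.
move=> a0 gP.
have act (i : int) (j k : nat) : i + k%:Z = j%:Z ->
    prodset (F i) (scale a (P j)) `<=` scale a (P k).
  move=> e _ [x Fx] [_ [y Py <-] <-]; rewrite mulrA; exists (x * y) => //.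
  exact: gliderM Fx Py e.
split=> [j|j|i j ij].
- by split; [apply: scale_zmod => //; exact: glider_zmod gP|apply: act; lia].
- by move=> _ [x Px <-]; exists x => //; apply: (glider_chain gP).
- by apply: act; lia.
Qed.

(** With [scale_glider], this provides the gliders [F_(-n) a]. *)
Lemma filt_glider F : is_filtration F -> is_glider F (fun j => F (- j%:Z)).
Proof.
move=> hF; have act (i : int) (j k : nat) : i + k%:Z = j%:Z ->
    prodset (F i) (F (- j%:Z)) `<=` F (- k%:Z).
  move=> e; have -> : - k%:Z = i + - j%:Z by lia.
  exact: filt_mul.
split=> [j|j|i j ij]; last by apply: act; lia.
- by split; [exact: (filt_additive hF)|apply: act; lia].
- by apply: (filt_mono hF); lia.
Qed.

(** * Irreducible gliders *)

(** Irreducibility is only ever tested on subgliders of the form [P a].  Since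
    multiplication by [a] is injective, [P a] is of type (T1) or (T2) in [M]
    only if [P] itself satisfies the corresponding equality. *)
Lemma irr_scale F M P a : is_irreducible F M -> is_glider F P -> a != 0 ->
    (forall n, scale a (P n) `<=` M n) ->
    (forall n, P n = body P -> M n = body M) ->
    (forall n, P n = [set 0] -> M n = [set 0]) ->
  trivial3 M (fun n => scale a (P n)).
Proof.
move=> iM gP a0 sPM Pb P0.
have sP : is_subglider F M (fun n => scale a (P n)).
  by split=> //; exact: scale_glider.
case: (irr_trivial iM sP) => // [[n [E nM]]|[n [E]]].
- case: nM; apply: Pb; apply/seteqP; split=> x Px; last exact: (Px n I).
  have: scale a (P n) (x * a) by exists x.
  by rewrite E => bx j _; have /scaleP-/(_ a0) := bx j I; rewrite mulfK.
- by case; apply: P0; exact: scale_eq0 E.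
Qed.

Section Irreducible.

Variables (F : int -> set K) (M : nat -> set K).
Hypotheses (hF : is_filtration F) (iM : is_irreducible F M).

Let gM := irr_glider iM.

(** If [a] is in [M_0] then [F_(-n) a] is contained in [M_n]. *)
Lemma irr_elt n : exists2 x, x != 0 & M n x.
Proof.
have [k /(zmod_neq0 (glider_zmod gM)) [a a0 Ma]] := irr_neq0 iM.
have {}Ma := glider_mono gM (leq0n k) Ma.
have [f f0 Ff] := zmod_neq0 (filt_additive hF (- n%:Z)) (filt_neq0 hF (n := _)).
exists (f * a); first by rewrite mulf_neq0.
by apply: (gliderM gM Ff Ma); lia.
Qed.

(** [F_(-n) a] has nonzero terms and zero body, which leaves only (T3);
    its first term is [F_0 a]. *)
Lemma irr_cyclic a : a != 0 -> M 0 a -> exists i, scale a (F 0) = M i.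
Proof.
move=> a0 Ma; have nF n : F n <> body (fun j => F (- j%:Z)).
  move=> E; apply: (filt_neq0 hF (n := n)); rewrite E; apply/seteqP; split=> x.
    by move=> /= bx; apply: (filt_body hF) => j; exact: bx.
  by move=> /= -> j _; apply: zmod_set0; exact: filt_additive.
have [| n | n | alpha [_ E _]] := irr_scale iM (filt_glider hF) a0.
- move=> n _ [x Fx <-]; apply: (gliderM gM Fx Ma); lia.
- by move=> /nF.
- by move=> /(filt_neq0 hF).
by exists (alpha 0%N); rewrite -E.
Qed.

(** The cyclic modules generated by the elements of [X] are terms of [M].  An
    element whose module comes first in [M] generates the others, because [M]
    decreases. *)
Lemma irr_generator X : X `<=` M 0 -> (exists2 x, x != 0 & X x) ->
  exists a, [/\ a != 0, X a & X `<=` scale a (F 0)].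
Proof.
move=> XM [x x0 Xx].
pose p := [pred i | `[< exists a, [/\ a != 0, X a & scale a (F 0) = M i] >]].
have exp : exists i, p i.
  have [i Ei] := irr_cyclic x0 (XM _ Xx).
  by exists i; apply/asboolP; exists x.
case: (ex_minnP exp) => i /asboolP [a [a0 Xa Ea]] imin.
exists a; split=> // y Xy; rewrite Ea.
have [->|y0] := eqVneq y 0; first exact: zmod_set0 (glider_zmod gM).
have [j Ej] := irr_cyclic y0 (XM _ Xy).
have ij : (i <= j)%N by apply: imin; apply/asboolP; exists y.
apply: (glider_mono gM ij); rewrite -Ej; exists 1; last by rewrite mul1r.
exact: filt01.
Qed.

End Irreducible.

(** * Discrete valuations *)

(** The valuation of [x <> 0] is the unique [n] for which [x / t ^ n] is a unit
    of [A].  It exists for [x] in [A] because one can divide by [t] until the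
    next quotient leaves [A], and for the other [x] because [x^-1] is in [A]. *)
Lemma dvr_of_uniformizer A t : zmod_closed [in A] -> A 1 ->
    (forall x y, A x -> A y -> A (x * y)) ->
    (forall x, A x \/ A x^-1) ->
    A t -> ~ A t^-1 ->
    (forall x, A x -> ~ A x^-1 -> A (x / t)) ->
    (forall x, x != 0 -> exists n, ~ A (x / t ^+ n)) ->
  riemann_surface K A.
Proof.
move=> Az A1 AM Atot At nAt Adiv Aarch.
have t0 : t != 0 by apply/eqP => t0; apply: nAt; rewrite t0 invr0 -t0.
pose U x := A x /\ A x^-1.
have tX0 (n : int) : t ^ n != 0 by apply: expfz_neq0.
have AX n : A (t ^+ n).
  by elim: n => [|n IH]; rewrite ?expr0 // exprS; exact: AM.
have UM x y : U x -> U y -> U (x * y).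
  by move=> [Ax Ax'] [Ay Ay']; split; rewrite ?invfM; apply: AM.
have exA x : x != 0 -> A x -> exists n : nat, U (x / t ^+ n).
  move=> x0 Ax; pose p := [pred n | `[< ~ A (x / t ^+ n) >]].
  have exp : exists n, p n by have [n nA] := Aarch x x0; exists n; apply/asboolP.
  case: (ex_minnP exp) => -[|n] /asboolP nA nmin.
    by case: nA; rewrite expr0 divr1.
  have Axn : A (x / t ^+ n).
    apply: contrapT => nA'; have : p n by apply/asboolP.
    by move=> /nmin; rewrite ltnn.
  exists n; split=> //; apply: contrapT => nAV; apply: nA.
  by rewrite exprSr invfM mulrA; exact: Adiv.
have exU x : exists n : int, x != 0 -> U (x / t ^ n).
  have [->|x0] := eqVneq x 0; first by exists 0.
  have [Ax|Ax] := Atot x.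
    by have [n Un] := exA x x0 Ax; exists n%:Z.
  have [|n [An An']] := exA x^-1 _ Ax; first by rewrite invr_eq0.
  exists (- n%:Z) => _; rewrite -invr_expz invrK.
  by split; [rewrite invfM !invrK in An'|rewrite invfM].
have /choice [v vU] := exU.
have nU (n : int) : U (t ^ n) -> n <= 0.
  case: n => // -[//|n] [_ A']; case: nAt.
  have -> : t^-1 = t ^+ n * (t ^+ n.+1)^-1.
    by rewrite exprS invfM mulrCA mulfV ?mulr1 // expf_neq0.
  by apply: AM => //; exact: AX.
have Uuniq x (m n : int) : x != 0 -> U (x / t ^ m) -> U (x / t ^ n) -> m = n.
  have aux (p q : int) : x != 0 -> U (x / t ^ p) -> U (x / t ^ q) -> p <= q.
    move=> x0 Up [Aq Aq']; rewrite -subr_le0; apply: nU.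
    have -> : t ^ (p - q) = (x / t ^ q) * (x / t ^ p)^-1.
      rewrite expfzDr // -invr_expz invfM invrK mulrACA mulfV // mul1r.
      by rewrite mulrC.
    by apply: UM => //; case: Up; split => //; rewrite invrK.
  by move=> x0 Um Un; apply/eqP; rewrite eq_le !aux.
have v0P x : x != 0 -> 0 <= v x <-> A x.
  move=> x0; have [Ax Ax'] := vU _ x0; split.
    move=> v0; have -> : x = x / t ^ v x * t ^ v x by rewrite mulfVK.
    by apply: AM => //; case: (v x) v0 => // n _; exact: AX.
  move=> A_x; rewrite leNgt; apply/negP => v0; have := Ax'.
  case E: (v x) v0 Ax => [//|n] _; rewrite NegzE -invr_expz invrK invfM => _ A'.
  (* If [x] is in [A] and [v x = - n.+1], then [t^-1] is in [A]. *)
  apply: nAt; have -> : t^-1 = (x^-1 / t ^+ n.+1) * (x * t ^+ n).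
    rewrite mulrACA mulVf // mul1r exprS invfM -mulrA mulVf ?mulr1 //.
    by rewrite expf_neq0.
  by apply: (AM _ _ A'); apply: AM => //; exact: AX.
have vM x y : x != 0 -> y != 0 -> v (x * y) = v x + v y.
  move=> x0 y0; have xy0 : x * y != 0 by rewrite mulf_neq0.
  apply: (Uuniq _ _ _ xy0); first exact: vU.
  by rewrite expfzDr // invfM mulrACA; apply: UM; exact: vU.
have v1 : v 1 = 0.
  apply: (Uuniq 1); first exact: oner_neq0.
    by apply: vU; exact: oner_neq0.
  by rewrite expr0z divr1; split; rewrite ?invr1.
have vV x : x != 0 -> v x^-1 = - v x.
  move=> x0; apply/eqP; rewrite -subr_eq0 opprK -vM ?invr_eq0 //.
  by rewrite mulVf // v1.
exists v.
  split=> //.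
    have aux x y : x != 0 -> y != 0 -> x + y != 0 -> v x <= v y -> v x <= v (x + y).
      move=> x0 y0 xy0 vxy; rewrite -subr_ge0 -vV // -vM ?invr_eq0 //.
      have yx : A (y / x).
        by apply/v0P; rewrite ?mulf_neq0 ?invr_eq0 // vM ?invr_eq0 // vV // subr_ge0.
      apply/v0P; first by rewrite mulf_neq0 ?invr_eq0.
      by rewrite mulrDl mulfV //; exact: zmod_setD.
    move=> x y x0 y0 xy0; rewrite ge_min; apply/orP.
    have [vxy|vyx] := leP (v x) (v y); first by left; exact: aux.
    by right; rewrite addrC; apply: aux => //; [rewrite addrC|exact: ltW].
  move=> n; exists (t ^ n) => //; apply: (Uuniq (t ^ n)) => //; first exact: vU.
  by rewrite divff //; split; rewrite ?invr1.
apply/seteqP; split=> x /=.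
  by move=> Ax; have [->|x0] := eqVneq x 0; [left|right; apply/v0P].
case=> [->|v0]; first exact: zmod_set0.
by have [->|x0] := eqVneq x 0; [exact: zmod_set0|apply/v0P].
Qed.

Section IrreducibleDvr.

Variables (F : int -> set K) (M : nat -> set K).
Hypotheses (hF : is_filtration F) (iM : is_irreducible F M).

Let gM := irr_glider iM.

(** Exhaustiveness moves [x] into [M_0]: [x] is in some [F_n], and then [x b] is
    in [M_0] for [b] in [M_n].  Of the elements [x b] and [b], one generates the
    other. *)
Lemma irr_total x : F 0 x \/ F 0 x^-1.
Proof.
have [->|x0] := eqVneq x 0.
  by left; exact: zmod_set0 (filt_additive hF _).
have [n Fx] := filt_elt x hF; have [b b0 Mb] := irr_elt hF iM n.
have Mxb : M 0 (x * b) by apply: (gliderM gM Fx Mb); lia.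
have {}Mb := glider_mono gM (leq0n n) Mb.
have XM : [set x * b; b] `<=` M 0 by move=> y /= [->|->].
have [|c [c0 [->|->] Xc]] := irr_generator hF iM XM.
- by exists b => //; right.
- have xb0 : x * b != 0 by rewrite mulf_neq0.
  have /scaleP-/(_ xb0) := Xc b (or_intror erefl).
  by rewrite invfM mulrCA mulfV // mulr1; right.
- have /scaleP-/(_ b0) := Xc (x * b) (or_introl erefl).
  by rewrite mulfK //; left.
Qed.

(** Generators of suitable subsets of [M_0] give the uniformizer and the absence
    of elements that are divisible by all of its powers. *)
Lemma irr_dvr : riemann_surface K (F 0).
Proof.
have [a a0 Ma] := irr_elt hF iM 0.
have F0Ma x : F 0 x -> M 0 (x * a).
  by move=> Fx; apply: (gliderM gM Fx Ma); lia.
(* A generator of the nonunits of [F 0], times [a]. *)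
pose X := [set y * a | y in [set y | F 0 y /\ ~ F 0 y^-1]].
have [||c [c0 [t [Ft nFt] tc] Xt]] := irr_generator hF iM (X := X).
- by move=> _ [y [Fy _] <-]; exact: F0Ma.
- apply: contrapT => nX; apply: (filt_neqT hF); exists 0.
  apply/seteqP; split=> // x _; case: (irr_total x) => // Fx.
  apply: contrapT => nFx; apply: nX; exists (x^-1 * a).
    rewrite mulf_neq0 // invr_eq0; apply/eqP => x0.
    by apply: nFx; rewrite x0; exact: zmod_set0 (filt_additive hF _).
  by exists x^-1 => //; split; rewrite ?invrK.
subst c; have t0 : t != 0.
  by apply: contraNneq c0 => ->; rewrite mul0r.
apply: (dvr_of_uniformizer (t := t)) => //.
- exact: (filt_additive hF).
- exact: filt01.
- by move=> x y; exact: filt0M.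
- exact: irr_total.
- move=> x Fx nFx; have : X (x * a) by exists x.
  by move=> /Xt/scaleP-/(_ c0); rewrite invfM mulrACA mulfV ?mulr1 // -mulrA.
move=> x x0; apply: contrapT => nex.
have Fxt n : F 0 (x / t ^+ n) by apply: contrapT => H; apply: nex; exists n.
(* If all [x / t ^+ n] were in [F 0], then one of them would generate the next,
   and [t] would be a unit. *)
pose Y := [set x / t ^+ n * a | n in [set: nat]].
have [||d [d0 [n _ dE] Yn]] := irr_generator hF iM (X := Y).
- by move=> _ [n _ <-]; exact: F0Ma.
- exists (x / t ^+ 0 * a); last by exists 0%N.
  by rewrite expr0 divr1 mulf_neq0.
subst d; have /Yn/scaleP-/(_ d0) : Y (x / t ^+ n.+1 * a) by exists n.+1.
suff -> : x / t ^+ n.+1 * a / (x / t ^+ n * a) = t^-1 by [].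
have tn0 : t ^+ n != 0 by rewrite expf_neq0.
rewrite -mulf_div divff // mulr1 exprS; apply: (canLR (mulfK _)).
  by rewrite mulf_neq0 // invr_eq0.
by rewrite invfM mulrCA.
Qed.

End IrreducibleDvr.

(** * Fractional ideals of a discrete valuation ring *)

(** All nonzero fractional ideals of [valuation_ring v] have this form, and
    [ball v 0] is convertible to [valuation_ring v]. *)
Definition ball v (n : int) : set K := [set x | x = 0 \/ n <= v x].

Section Ball.

Variable v : K -> int.
Hypothesis hv : is_discrete_valuation v.

Lemma dv1 : v 1 = 0.
Proof.
have := dv_mul hv (oner_neq0 K) (oner_neq0 K).
by rewrite mulr1 => /eqP; rewrite -subr_eq0 opprD addNKr oppr_eq0 => /eqP.
Qed.

Lemma dvV x : x != 0 -> v x^-1 = - v x.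
Proof.
move=> x0; apply/eqP; rewrite -subr_eq0 opprK -(dv_mul hv) ?invr_eq0 //.
by rewrite mulVf // dv1.
Qed.

Lemma dvN x : x != 0 -> v (- x) = v x.
Proof.
move=> x0; have n10 : -1 != 0 :> K by rewrite oppr_eq0 oner_eq0.
have := dv_mul hv n10 n10; rewrite mulrNN mulr1 dv1 => vN1.
by rewrite -mulN1r (dv_mul hv) //; lia.
Qed.

Lemma ballP n x : x != 0 -> ball v n x <-> n <= v x.
Proof. by move=> /eqP x0; split=> [[//|]|]; [|right]. Qed.

Lemma ball_elt n : exists x, [/\ x != 0, v x = n & ball v n x].
Proof. by have [x x0 vx] := dv_surj hv n; exists x; split=> //; right; rewrite vx. Qed.

Lemma ball_zmod n : zmod_closed [in ball v n].
Proof.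
apply/zmod_setP; split; first by left.
move=> x y [->|vx] [->|vy].
- by left; rewrite subr0.
- have [->|y0] := eqVneq y 0; first by left; rewrite subr0.
  by right; rewrite sub0r dvN.
- by right; rewrite subr0.
have [->|x0] := eqVneq (x - y) 0; first by left.
have [->|nx0] := eqVneq x 0.
  have [->|y0] := eqVneq y 0; first by left; rewrite subr0.
  by right; rewrite sub0r dvN.
have [->|y0] := eqVneq y 0; first by right; rewrite subr0.
have ny0 : - y != 0 by rewrite oppr_eq0.
right; apply: le_trans (dv_add hv nx0 ny0 x0).
by rewrite le_min vx dvN.
Qed.

Lemma ballM m n x y : ball v m x -> ball v n y -> ball v (m + n) (x * y).
Proof.
have [->|x0] := eqVneq x 0; first by left; rewrite mul0r.
have [->|y0] := eqVneq y 0; first by left; rewrite mulr0.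
rewrite !ballP ?mulf_neq0 // (dv_mul hv) // => vx vy; exact: lerD.
Qed.

Lemma ball_mono m n : m <= n -> ball v n `<=` ball v m.
Proof. by move=> mn x [->|vx]; [left|right; exact: le_trans vx]. Qed.

Lemma ball_le m n : ball v m `<=` ball v n -> n <= m.
Proof. by move=> s; have [x [x0 vx Bx]] := ball_elt m; rewrite -vx; apply/(ballP _ x0)/s. Qed.

Lemma ball_inj : injective (ball v).
Proof. by move=> m n E; apply/eqP; rewrite eq_le !ball_le // E. Qed.

Lemma ball_neq0 n : ball v n <> [set 0].
Proof. by move=> E; have [x [/eqP x0 _]] := ball_elt n; rewrite E. Qed.

Lemma scale_ball a n : a != 0 -> scale a (ball v n) = ball v (n + v a).
Proof.
move=> a0; apply/seteqP; split=> x.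
  by move=> [y By <-]; apply: ballM => //; right.
move=> Bx; apply/scaleP => //; have -> : n = n + v a + v a^-1.
  by rewrite dvV // addrK.
by apply: ballM => //; right.
Qed.

Lemma ball_filtration : is_filtration (fun n => ball v (- n)).
Proof.
split=> [n|n|n m _ [x Bx [y By <-]]||||n|[m E]].
- exact: ball_zmod.
- by apply: ball_mono; lia.
- by rewrite opprD; exact: ballM.
- rewrite oppr0; split=> [|x y|x y].
  + by apply: mem_set; right; rewrite dv1.
  + move=> /set_mem Bx /set_mem By; apply: mem_set.
    by apply: zmod_setB => //; exact: ball_zmod.
  + move=> /set_mem Bx /set_mem By; apply: mem_set.
    by rewrite -(addr0 0); exact: ballM.
- apply/seteqP; split=> [x Bx|x -> n _]; last by left.
  apply: contrapT => /eqP x0.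
  have /(ballP _ x0) := Bx (- (v x + 1)) I; lia.
- apply/seteqP; split=> // x _; exists (- v x) => //; right; lia.
- exact: ball_neq0.
- have [x [x0 vx _]] := ball_elt (- m - 1).
  have : [set: K] x by [].
  rewrite -E => /(ballP _ x0); lia.
Qed.

(** Since [F_j N_j] lies in [N_0] and [F_(-j) N_0] lies in [N_j], the term [N_j]
    of a subglider is [t ^ j N_0].  So [N] is a shift of the chain unless it has
    a zero term. *)
Lemma ball_irreducible c :
  is_irreducible (fun n => ball v (- n)) (fun j => ball v (c + j%:Z)).
Proof.
have act (i : int) (j k : nat) : i + k%:Z = j%:Z ->
    prodset (ball v (- i)) (ball v (c + j%:Z)) `<=` ball v (c + k%:Z).
  move=> e _ [x Bx [y By <-]].
  have -> : c + k%:Z = - i + (c + j%:Z) by lia.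
  exact: ballM.
split.
- split=> [j|j|i j ij]; last by apply: act; lia.
    by split; [exact: ball_zmod|apply: act; lia].
  by apply: ball_mono; lia.
- by exists 0%N; exact: ball_neq0.
move=> N [gN sN].
have [[n Nn]|N0] := pselect (exists n, N n = [set 0]).
  by apply: Or32; exists n; split=> //; exact: ball_neq0.
(* The least valuation that occurs in [N 0] is [c + d]. *)
have [d [dP [a [a0 va Na]]]] : exists d : nat,
    (forall x, N 0%N x -> ball v (c + d%:Z) x) /\
    (exists a, [/\ a != 0, v a = c + d%:Z & N 0%N a]).
  have N00 : N 0%N <> [set 0] by move=> E; apply: N0; exists 0%N.
  pose p := [pred d : nat |
    `[< exists a, [/\ a != 0, v a = c + d%:Z & N 0%N a] >]].
  have pv x : x != 0 -> N 0%N x -> p `|v x - c|%N /\ c <= v x.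
    move=> x0 Nx; have /(ballP _ x0) vx := sN 0%N x Nx; split; last lia.
    apply/asboolP; exists x; split=> //; lia.
  have [x x0 Nx] := zmod_neq0 (glider_zmod gN) N00.
  have exp : exists d, p d by exists `|v x - c|%N; case: (pv x x0 Nx).
  case: (ex_minnP exp) => d /asboolP pd dmin.
  exists d; split=> // y Ny; have [->|y0] := eqVneq y 0; first by left.
  right; have [/dmin dy cy] := pv y y0 Ny; lia.
have NE j : N j = ball v (c + (d + j)%N%:Z).
  apply/seteqP; split=> x.
    move=> Nx; have [t [t0 vt Bt]] := ball_elt (- j%:Z).
    have /dP Ntx : N 0%N (t * x) by apply: (gliderM gN (i := j%:Z) Bt Nx); lia.
    have -> : x = t^-1 * (t * x) by rewrite mulKf.
    have -> : c + (d + j)%N%:Z = v t^-1 + (c + d%:Z) by rewrite dvV //; lia.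
    by apply: ballM => //; right.
  have -> : c + (d + j)%N%:Z = j%:Z + v a by lia.
  rewrite -scale_ball // => -[y By <-].
  by apply: (gliderM gN (i := - j%:Z) _ Na); [rewrite opprK|lia].
apply: Or33; exists (fun j => d + j)%N; split=> [m n mn|//|m n mn]; lia.
Qed.

End Ball.

(** * Irreducible gliders as chains of fractional ideals *)

Section IrreducibleBalls.

Variables (F : int -> set K) (M : nat -> set K) (v : K -> int).
Hypotheses (hF : is_filtration F) (iM : is_irreducible F M).
Hypotheses (hv : is_discrete_valuation v) (F0 : F 0 = ball v 0).

Let gM := irr_glider iM.

Lemma irr_ball : exists m : nat -> int, M = fun j => ball v (m j).
Proof.
suff /choice[m mE] : forall j, exists n, M j = ball v n.
  by exists m; apply: funext.
move=> j; have MjM : M j `<=` M 0%N by exact: (glider_mono gM).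
have [a [a0 Ma Mja]] := irr_generator hF iM MjM (irr_elt hF iM j).
rewrite F0 scale_ball // in Mja; exists (0 + v a).
apply/seteqP; split=> // x; rewrite -scale_ball // -F0 => -[y Fy <-].
by apply: (gliderM gM Fy Ma); lia.
Qed.

(** Type (T3) of the subglider [t M], for a uniformizer [t], means that raising
    [m] by one amounts to advancing the index from [n] to [alpha n], where
    [alpha n - n] is nondecreasing.  Since [m] grows by at least 2 over [2 p]
    steps, where [t^-1] is in [F_p], this difference is bounded by [2 p]. *)
Lemma irr_periodic (m : nat -> int) : M = (fun j => ball v (m j)) ->
  exists N s : nat, forall n, (N <= n)%N -> m (n + s)%N = m n + 1.
Proof.
move=> ME.
have [t [t0 vt Bt]] := ball_elt hv 1.
have [|alpha [_ alphaM alphaD]] := irr_scale iM gM t0 _ (fun _ => id) (fun _ => id).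
  move=> n _ [x Mx <-]; rewrite mulrC; have Ft : F 0 t.
    by rewrite F0; apply: ball_mono Bt.
  by apply: (gliderM gM Ft Mx); lia.
have mal n : m (alpha n) = m n + 1.
  apply: (ball_inj hv); rewrite -vt -(scale_ball hv) //.
  by have := alphaM n; rewrite ME.
have [p Fp] := filt_elt t^-1 hF.
have mp n : m n + 1 <= m (n + p)%N.
  rewrite -lerBrDr; apply: (ball_le hv) => x Bx.
  have -> : x = t^-1 * (x * t) by rewrite mulrC mulfK.
  have Bxt : M (n + p)%N (x * t).
    rewrite ME; have -> : m (n + p)%N = m (n + p)%N - 1 + v t by rewrite vt subrK.
    by rewrite -scale_ball //; exists x.
  by have := gliderM gM Fp Bxt (k := n); rewrite ME; apply; lia.
have mmono i j : (i <= j)%N -> m i <= m j.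
  by move=> ij; apply: (ball_le hv); have := glider_mono gM ij; rewrite ME.
have al n : (alpha n < n + p + p)%N.
  rewrite ltnNge; apply/negP => /mmono; have := mp n; have := mp (n + p)%N.
  by rewrite mal; lia.
have alS i n : (i <= n)%N -> (alpha i - i <= alpha n - n)%N /\ (n <= alpha n)%N.
  by move=> i_n; have := alphaD (n - i)%N n; have := alphaD n n; rewrite subKn //; lia.
pose q := [pred s : nat | `[< exists n, (alpha n - n)%N = s >]].
have exq : exists s, q s by exists (alpha 0 - 0)%N; apply/asboolP; exists 0%N.
have qle s : q s -> (s <= p + p)%N.
  by move=> /asboolP [n <-]; have := al n; lia.
case: (ex_maxnP exq qle) => s /asboolP [N Ns] smax.
exists N, s => n Nn; rewrite -mal; congr m.
have := smax (alpha n - n)%N; have [] := alS _ _ Nn.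
have qn : q (alpha n - n)%N by apply/asboolP; exists n.
by move=> ? ? /(_ qn); lia.
Qed.

End IrreducibleBalls.

(** * Countability *)

(** The general form of a sequence that satisfies [m (n + s) = m n + 1] from
    [n = N] on: [l] lists its first [N + s] values. *)
Definition staircase (c : nat * nat * seq int) (j : nat) : int :=
  let: (N, s, l) := c in
  if (j < N)%N then nth 0 l j
  else nth 0 l (N + (j - N) %% s)%N + ((j - N) %/ s)%N%:Z.

Lemma staircase_onto (m : nat -> int) (N s : nat) :
    (forall n, (N <= n)%N -> m (n + s)%N = m n + 1) ->
  exists c, m = staircase c.
Proof.
move=> mS; have s0 : (0 < s)%N.
  by rewrite lt0n; apply/eqP => s0; have := mS N (leqnn N); rewrite s0 addn0; lia.
have mSk k n : (N <= n)%N -> m (n + k * s)%N = m n + k%:Z.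
  elim: k => [|k IH] Nn; first by rewrite addn0 addr0.
  rewrite mulSn addnCA addnC mS; last exact: leq_trans (leq_addr _ _).
  by rewrite IH //; lia.
exists (N, s, mkseq m (N + s)); apply: funext => j /=.
case: ltnP => jN; first by rewrite nth_mkseq // ltn_addr.
rewrite nth_mkseq ?ltn_add2l ?ltn_mod // -mSk ?leq_addr //; congr m.
by rewrite -addnA [(_ %% _ + _)%N]addnC -divn_eq subnKC.
Qed.

Lemma choose_valuation : exists val : set K -> K -> int,
  forall A, riemann_surface K A ->
    is_discrete_valuation (val A) /\ A = ball (val A) 0.
Proof.
suff /choice[val valP] : forall A : set K, exists v, riemann_surface K A ->
    is_discrete_valuation v /\ A = ball v 0 by exists val.
move=> A; have [[v hv ->]|nA] := pselect (riemann_surface K A); first by exists v.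
by exists (fun=> 0) => /nA.
Qed.

(** An irreducible glider is determined by its ring [F_0] and by the integer that
    encodes the data of its staircase. *)
Lemma GBS_card_le : (GBS K #<= riemann_surface K `*` [set: int])%card.
Proof.
have [val valP] := choose_valuation.
pose code (z : int) : nat * nat * seq int := odflt (0, 0, [::])%N (unpickle `|z|%N).
pose D (p : set K * int) j := ball (val p.1) (staircase (code p.2) j).
apply: card_le_trans (card_image_le D _); apply: subset_card_le.
move=> M [F hF iM]; have RF := irr_dvr hF iM; have [hv F0] := valP _ RF.
have [m ME] := irr_ball hF iM hv F0.
have [N [s mS]] := irr_periodic hF iM hv F0 ME.
have [c mc] := staircase_onto mS.
exists (F 0, (pickle c)%:Z) => //.
by apply: funext => j; rewrite /D /code /= pickleK /= -mc ME.
Qed.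

(** The chain [{v >= c + j}] determines the ring of [v], which is the multiplier
    ring of its first term, and [c]. *)
Lemma card_le_GBS : (riemann_surface K `*` [set: int] #<= GBS K)%card.
Proof.
have [val valP] := choose_valuation.
pose E (p : set K * int) (j : nat) := ball (val p.1) (p.2 + j%:Z).
apply/pcard_leP/injfunPex; exists E.
  move=> [A c] [/= RA _]; have [hv _] := valP A RA.
  exists (fun n => ball (val A) (- n)); first exact: ball_filtration.
  exact: ball_irreducible.
have ring A c : riemann_surface K A ->
    A = [set x | forall y, E (A, c) 0%N y -> E (A, c) 0%N (x * y)].
  move=> RA; have [hv AE] := valP A RA; rewrite /E /= addr0.
  apply/seteqP; split=> x /=.
    by rewrite {1}AE => Ax y By; rewrite -(add0r c); exact: ballM.
  have [y [y0 vy By]] := ball_elt hv c.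
  move=> /(_ _ By) Bxy; rewrite AE; have [->|x0] := eqVneq x 0; first by left.
  right; move: Bxy => /(ballP _ _ (mulf_neq0 x0 y0)).
  by rewrite (dv_mul hv) // vy; lia.
move=> [A c] [B d] /set_mem [/= RA _] /set_mem [/= RB _] EE.
have AB : A = B by rewrite (ring A c RA) (ring B d RB) EE.
subst B; congr pair; have [hv _] := valP A RA.
have := congr1 (@^~ 0%N) EE; rewrite /E /= !addr0; exact: ball_inj.
Qed.

End GliderIdeals.

(** A set with a distinguished element is what allows a bijection between two
    subsets to be extended to a total function. *)
HB.instance Definition _ := isPointed.Build int 0%R.

Theorem theorem3p11 (K : fieldType) :
  exists f : (nat -> set K) -> set K * int,
    set_bij (GBS K) (riemann_surface K `*` [set: int]) f.
Proof.
apply/card_set_bijP; apply: Cantor_Bernstein.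
- exact: GBS_card_le.
- exact: card_le_GBS.
Qed.
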